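(* Let $G$ be a finite group. If the difference subgroup graph $D(G)$ has at least one edge, then the girth of $D(G)$ is $3$ or $4$.
   Context: For a finite group $G$, the difference subgroup graph $D(G)$ is the undirected graph whose vertices are the non-trivial proper subgroups of $G$, with two distinct vertices $H$ and $K$ adjacent if and only if $\langle H,K\rangle = G$ and $HK\neq G$, where $HK=\{hk : h\in H,\ k\in K\}$. The girth of a graph is the length of a shortest cycle in it. *)

(* Defs.v *)
From HB Require Import structures.
From mathcomp Require Import all_boot all_fingroup.

Set Implicit Arguments.
Unset Strict Implicit.
Unset Printing Implicit Defensive.

Local Open Scope group_scope.

(* [ucycle e c] already contains the closing edge from the last vertex of [c]
   to the first and the distinctness of the vertices; the length bound discards
   the empty sequence and an edge walked back and forth. *)
Definition graph_cycle (T : finType) (e : rel T) (c : seq T) : Prop :=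
  2 < size c /\ ucycle e c.

(* An acyclic graph (infinite girth) satisfies [is_girth e g] for no [g]. *)
Definition is_girth (T : finType) (e : rel T) (g : nat) : Prop :=
  (exists2 c : seq T, graph_cycle e c & size c = g) /\
  (forall c : seq T, graph_cycle e c -> g <= size c).

Definition dsg_vertex (gT : finGroupType) (G : {group gT}) : finType :=
  {H : {group gT} | (H :!=: 1) && (H \proper G)}.

Definition dsg_adj (gT : finGroupType) (G : {group gT}) : rel (dsg_vertex G) :=
  fun H K => [&& H != K, val H <*> val K == G & val H * val K != G].

Lemma dsg_adj_sym (gT : finGroupType) (G : {group gT}) :
  symmetric (@dsg_adj gT G).
Proof.
suff sub (H K : dsg_vertex G) : dsg_adj H K -> dsg_adj K H.
  by move=> H K; apply/idP/idP; apply: sub.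
case/and3P=> neqHK genHK prodHK; apply/and3P; split.
- by rewrite eq_sym.
- by rewrite joingC.
- apply: contraNneq prodHK => KH.
  by rewrite -(inj_eq (@invg_inj _)) invMg !invGid KH.
Qed.

Lemma dsg_adj_irr (gT : finGroupType) (G : {group gT}) :
  irreflexive (@dsg_adj gT G).
Proof. by move=> H; rewrite /dsg_adj eqxx. Qed.

(* Main.v *)
(* The condition [H * K != G] is invariant under replacing [H] and [K] by
   conjugates. If some maximal subgroup [M] is not normal, then it is
   self-normalizing of index at least 3, so it has three distinct conjugates, and
   these form a triangle. If every maximal subgroup is normal, then conjugating
   [H] and [K] does not change which maximal subgroups contain them, so an edge
   [H - K] gives a 4-cycle [H - K - H ^ k - K ^ h], where [k] in [K] and [h] in
   [H] do not normalize [H] and [K] respectively. *)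
Require Import Defs.
From mathcomp Require Import all_boot all_fingroup.
From mathcomp Require Import gseries.

Set Implicit Arguments.
Unset Strict Implicit.
Unset Printing Implicit Defensive.

Local Open Scope group_scope.

Section Girth.

Variables (T : finType) (e : rel T).

Lemma girth3 (x y z : T) :
  uniq [:: x; y; z] -> e x y -> e y z -> e z x -> is_girth e 3.
Proof.
move=> Uxyz exy eyz ezx; split; last by move=> c [].
exists [:: x; y; z] => //; split=> //.
by rewrite /ucycle /= exy eyz ezx.
Qed.

Lemma girth3_or_4 (x y z t : T) :
    uniq [:: x; y; z; t] -> e x y -> e y z -> e z t -> e t x ->
  is_girth e 3 \/ is_girth e 4.
Proof.
move=> Uxyzt exy eyz ezt etx.
(* The 3-tuples form a finite type, so the existence of a triangle is a boolean and the case split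
   is constructive. *)
have [/existsP[c cyc] | no3] := boolP [exists c : 3.-tuple T, ucycleb e c].
  left; split; last by move=> c' [].
  by exists c; [split=> // | ]; rewrite size_tuple.
right; split.
  exists [:: x; y; z; t] => //; split=> //.
  by rewrite /ucycle /= exy eyz ezt etx.
move=> c [c_gt2 cyc]; rewrite ltn_neqAle c_gt2 andbT.
apply: contraNneq no3 => c3; apply/existsP.
have sz_c : size c == 3 by rewrite -c3.
by exists (Tuple sz_c).
Qed.

End Girth.

Section Conjugates.

Variable gT : finGroupType.
Implicit Types G H K M : {group gT}.

(** Writing [x] itself as [h * k ^ x] with [h] in [H] and [k] in [K] gives [x = k * h]. Hence
    [K :^ x = K :^ h], and [H * K :^ h] is [H * K] conjugated by [h]. *)
Lemma mulG_conjg_eq G H K x :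
  H \subset G -> x \in G -> H * K :^ x = G -> H * K = G.
Proof.
move=> sHG Gx defG.
have: x \in H * K :^ x by rewrite defG.
case/mulsgP=> h _ Hh /imsetP[k Kk ->] defx.
have{}defx : x = k * h.
  have inv_kh: h * (x^-1 * k) = 1.
    by apply: (mulIg x); rewrite mul1g {3}defx /conjg !mulgA.
  by apply: (mulgI x^-1); rewrite mulVg mulgA -(mulg1_eq inv_kh) mulVg.
have Gh := subsetP sHG h Hh.
by apply: (@conjsg_inj _ h); rewrite conjsMg (conjGid Hh) (conjGid Gh) -[in RHS]defG
  defx conjsgM (conjGid Kk).
Qed.

Lemma mulGJ_eq G H K x y :
    H \subset G -> x \in G -> y \in G ->
  H :^ x * K :^ y = G -> H * K = G.
Proof.
move=> sHG Gx Gy defG.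
apply: (@mulG_conjg_eq _ _ _ (y * x^-1)); rewrite ?groupM ?groupV //.
by apply: (@conjsg_inj _ x); rewrite conjsMg -conjsgM mulgKV defG conjGid.
Qed.

Lemma conjG_vertexP G (H : dsg_vertex G) x :
  x \in G -> (val H :^ x != 1) && (val H :^ x \proper G).
Proof.
case: H => H /= /andP[ntH prH] Gx.
have := properJ H G x; rewrite (conjGid Gx) prH => ->.
by rewrite -(conjs1g x) (inj_eq (@conjsg_inj _ x)) ntH.
Qed.

Definition conj_vertex G (H : dsg_vertex G) x (Gx : x \in G) : dsg_vertex G :=
  Sub (val H :^ x)%G (conjG_vertexP H Gx).

Lemma vertex_sub G (H : dsg_vertex G) : val H \subset G.
Proof. by case: H => H /= /andP[_ /proper_sub]. Qed.

(** A proper join would equal [M] by maximality, so [N] would lie in [M] and, having the same order,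
    coincide with it. A product equal to [G] would force [M * M = G], that is [M = G]. *)
Lemma maximal_neq_adj G (M N : dsg_vertex G) x :
    maximal (val M) G -> x \in G -> val N :=: val M :^ x -> M != N ->
  dsg_adj M N.
Proof.
move=> maxM Gx defN neqMN; apply/and3P; split=> //.
  have [_ maxMP] := maxgroupP maxM.
  have: val M <*> val N \subset G by rewrite join_subG !vertex_sub.
  rewrite subEproper => /orP[// | prMN].
  have defM := maxMP _ prMN (joing_subl _ _).
  have sNM : val N \subset val M by rewrite -defM joing_subr.
  case/eqP: neqMN; apply: val_inj; apply: val_inj => /=.
  by apply/esym/eqP; rewrite eqEcard sNM defN cardJg leqnn.
apply/eqP; rewrite defN => /(mulG_conjg_eq (vertex_sub M) Gx).
rewrite mulGid => defM; have := maxgroupp maxM.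
by rewrite /= defM properxx.
Qed.

Lemma nonnormal_maximal_girth3 G M :
  maximal M G -> ~~ (M <| G) -> is_girth (@dsg_adj gT G) 3.
Proof.
move=> maxM nnM; have prM : M \proper G := maxgroupp maxM.
have sMG := proper_sub prM.
have vM : (M :!=: 1) && (M \proper G).
  by rewrite prM andbT; apply: contraNneq nnM => ->; apply: normal1.
pose V : dsg_vertex G := Sub M vM.
have defN : 'N_G(M) = M.
  have [_ maxMP] := maxgroupP maxM.
  apply: (maxMP 'N_G(M)%G); last by rewrite subsetI sMG normG.
  rewrite properE subsetIl /=; apply: contra nnM.
  by rewrite subsetI => /andP[_ nMG]; apply/andP.
(* As [M] is its own normalizer, its conjugates number [#|G : M|]. This is not 1 because [M] is
   proper, and not 2 because a subgroup of index 2 is normal. *)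
have: 2 < #|M :^: G|.
  rewrite card_conjugates defN ltn_neqAle indexg_gt1 proper_subn // andbT.
  by apply: contra nnM => /eqP iM; apply: index2_normal.
case/card_gt2P=> A [B] [C] [[]].
case/imsetP=> a Ga ->; case/imsetP=> b Gb ->; case/imsetP=> c Gc -> [nab nbc nca].
have adj x y (Gx : x \in G) (Gy : y \in G) : M :^ x != M :^ y ->
    dsg_adj (conj_vertex V Gx) (conj_vertex V Gy).
  move=> nxy; apply: (@maximal_neq_adj _ _ _ (x^-1 * y)).
  - by rewrite /= -(conjGid Gx) maximalJ.
  - by rewrite groupM ?groupV.
  - by rewrite /= -conjsgM mulKVg.
  - by apply: contra nxy => /eqP[/= ->].
have neq u v : dsg_adj u v -> u != v :> dsg_vertex G by case/and3P.
have adj_ab := adj _ _ Ga Gb nab; have adj_bc := adj _ _ Gb Gc nbc.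
have adj_ca := adj _ _ Gc Ga nca.
apply: (girth3 _ adj_ab adj_bc adj_ca).
by rewrite /= !inE negb_or !neq // dsg_adj_sym.
Qed.

(** Otherwise some maximal [M] contains both conjugates; being normal, [M] equals [M :^ x] and
    [M :^ y], so it contains [H] and [K] as well, hence [G]. *)
Lemma joinGJ_eq G H K x y :
    (forall M, maximal M G -> M <| G) ->
    H \subset G -> K \subset G -> x \in G -> y \in G ->
  H <*> K = G -> H :^ x <*> K :^ y = G.
Proof.
move=> nmax sHG sKG Gx Gy defG.
have sJG : H :^ x <*> K :^ y \subset G.
  by rewrite join_subG !conj_subG.
have [// | [M maxM]] := maximal_exists sJG.
have nMG := normal_norm (nmax M maxM).
rewrite join_subG -{1}(normsP nMG x Gx) -{2}(normsP nMG y Gy) !conjSg => sM.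
have := proper_subn (maxgroupp maxM).
by rewrite -defG join_subG sM.
Qed.

(** If [K] normalized [H], the product [H * K] would be the join, which is [G]. *)
Lemma adj_conj_neq G (H K : dsg_vertex G) :
  dsg_adj H K -> exists2 k, k \in G & val H :^ k != val H.
Proof.
case/and3P=> _ /eqP defG neqG.
have /subsetPn[k Kk nHk]: ~~ (val K \subset 'N(val H)).
  by apply: contra neqG => nHK; rewrite -norm_joinEr ?defG.
exists k; first exact: (subsetP (vertex_sub K)).
by apply: contra nHk => /eqP Hk; rewrite inE Hk.
Qed.

End Conjugates.

Theorem corollary2p6 (gT : finGroupType) (G : {group gT})
    (hedge : exists H K : dsg_vertex G, dsg_adj H K) :
  is_girth (@dsg_adj gT G) 3 \/ is_girth (@dsg_adj gT G) 4.
Proof.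
have [/existsP[M /andP[maxM nnM]] | nmaxG] :=
  boolP [exists M : {group gT}, maximal M G && ~~ (M <| G)].
  by left; apply: nonnormal_maximal_girth3 maxM nnM.
have nmax (M : {group gT}) : maximal M G -> M <| G.
  by move=> maxM; apply: contraR nmaxG => nnM; apply/existsP; exists M; rewrite maxM.
case: hedge => H [K adjHK].
have [k Gk nHk] := adj_conj_neq adjHK.
have [h Gh nKh] : exists2 h, h \in G & val K :^ h != val K.
  by apply: (@adj_conj_neq _ _ _ H); rewrite dsg_adj_sym.
case/and3P: (adjHK) => _ /eqP defG neqG.
(* Stating the conjugacy as set equalities lets [H] and [K] themselves be used, as conjugates by
   1. *)
have adjP (A B : dsg_vertex G) x y : x \in G -> y \in G ->
    val A :=: val H :^ x -> val B :=: val K :^ y -> dsg_adj A B.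
  move=> Gx Gy defA defB.
  have neqAB : val A * val B != G.
    apply: contra neqG => /eqP; rewrite defA defB.
    by move=> /(mulGJ_eq (vertex_sub H) Gx Gy) ->.
  have joinAB : val A <*> val B = G.
    by rewrite defA defB (joinGJ_eq nmax) ?vertex_sub.
  apply/and3P; split=> //; last exact/eqP.
  (* For equal vertices the join and the product are the same subgroup. *)
  apply: contraNneq neqAB => eqAB; move: joinAB.
  by rewrite eqAB joingE setUid genGid mulGid => ->.
pose H' := conj_vertex H Gk; pose K' := conj_vertex K Gh.
have adjHK' : dsg_adj H K' by apply: (adjP _ _ 1 h); rewrite ?conjsg1.
have adjH'K : dsg_adj H' K by apply: (adjP _ _ k 1); rewrite ?conjsg1.
have adjH'K' : dsg_adj H' K' by apply: (adjP _ _ k h).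
have neq u v : dsg_adj u v -> u != v :> dsg_vertex G by case/and3P.
have neqHH' : H != H' by apply: contra nHk => /eqP {2}->.
have neqKK' : K != K' by apply: contra nKh => /eqP {2}->.
apply: (@girth3_or_4 _ _ H K H' K'); rewrite // 1?dsg_adj_sym //.
rewrite /= !inE !negb_or neqHH' neqKK' !neq //.
by rewrite dsg_adj_sym.
Qed.
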